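(* Let $X=(X_1,X_2)$ be an S$\alpha$S random vector with $\alpha\in(0,2]$ and spectral measure $\Gamma_X$. Then the scale parameter of $\theta_1X_1+\theta_2X_2$ to the power $\alpha$, $\sigma_X^\alpha(\theta_1,\theta_2)=\int_{S_2}|\theta_1s_1+\theta_2s_2|^\alpha\,\Gamma_X(ds)$, can be expressed, for all $(\theta_1,\theta_2)\in\mathbb R^2$, by the convergent series $$\sigma_X^\alpha(\theta_1,\theta_2)=\sum_{k=0}^{+\infty}\frac{(\alpha)_k}{k!}\,[\theta_1X_1,\theta_2X_2]_{\alpha,k,M(k)},$$ where $M(k)=(k \bmod 2)\in\{0,1\}$.
   Context: S$\alpha$S vectors: a real random vector $X=(X_1,\dots,X_d)$ is (jointly) S$\alpha$S with $\alpha\in(0,2]$ and spectral measure $\Gamma_X$ if $\Gamma_X$ is a symmetric finite nonnegative measure on the unit sphere $S_d=\{s\in\mathbb R^d:\|s\|=1\}$ (Euclidean norm) with $\mathbb E e^{i\langle\theta,X\rangle}=\exp\left(-\int_{S_d}|\langle\theta,s\rangle|^\alpha\,\Gamma_X(ds)\right)$ for all $\theta\in\mathbb R^d$. The spectral measure is unique if $\alpha<2$, but not if $\alpha=2$. Symmetric covariation: for an S$\alpha$S vector $(X_1,X_2)$ with spectral measure $\Gamma_X$, $\beta\ge0$ and $m\in\{0,1\}$, $[X_1,X_2]_{\alpha,\beta,m}=\int_{S_2}K_{\alpha,\beta,m}(s_1,s_2)\,\Gamma_X(ds)$, where $$K_{\alpha,\beta,m}(s_1,s_2)=|s_1|^{\beta}|s_2|^{\alpha-\beta}\,\mathrm{sign}^m(s_1s_2)\mathbf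 1_{\{|s_1|\le|s_2|\}}+|s_1|^{\alpha-\beta}|s_2|^{\beta}\,\mathrm{sign}^m(s_1s_2)\mathbf 1_{\{|s_1|>|s_2|\}},$$ $\mathrm{sign}(a)=1,0,-1$ for $a>0$, $a=0$, $a<0$, and $0^0=1$ (in particular $\mathrm{sign}^0\equiv1$). Linear images: if $Y_1=\sum_k a_kX_k$, $Y_2=\sum_k b_kX_k$ with $X=(X_1,\dots,X_n)$ S$\alpha$S, then $(Y_1,Y_2)$ is S$\alpha$S; its spectral measure is taken to be the push-forward of the measure $\left((\sum_k a_ks_k)^2+(\sum_k b_ks_k)^2\right)^{\alpha/2}\Gamma_X(ds)$ on $S_n$ under $s\mapsto(\sum_k a_ks_k,\sum_k b_ks_k)/\|(\sum_k a_ks_k,\sum_k b_ks_k)\|$ (for $\alpha<2$ this is the only spectral measure). Falling factorial: for integers $k\ge0$, $(\alpha)_k=\Gamma(\alpha+1)/\Gamma(\alpha+1-k)$ if $\alpha\notin\mathbb Z_+$, or if $\alpha\in\mathbb Z_+$ and $k\le\alpha$; $(\alpha)_k=0$ otherwise ($\Gamma(\cdot)$ is the gamma function). *)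

(* Defs.v *)
From HB Require Import structures.
From mathcomp Require Import all_boot all_order all_algebra archimedean.
From mathcomp Require Import complex.
From mathcomp Require Import all_classical all_reals all_analysis.
From mathcomp Require Import measurable_realfun.

Set Implicit Arguments.
Unset Strict Implicit.
Unset Printing Implicit Defensive.

Import Order.TTheory GRing.Theory Num.Theory.
Import numFieldNormedType.Exports.

Local Open Scope classical_set_scope.
Local Open Scope ring_scope.

(* R^n, with the product of the Borel sigma-algebras. *)
Notation Rn R n := (n.-tuple (measurableTypeR R)).

Section euclidean.
Context {R : realType} {n : nat}.
Implicit Types a b s theta : Rn R n.

Definition dot theta s : R := \sum_(i < n) tnth theta i * tnth s i.

Definition enorm s : R := Num.sqrt (\sum_(i < n) tnth s i ^+ 2).

Definition opp_vec s : Rn R n := [tuple - tnth s i | i < n].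

Lemma measurable_dot theta : measurable_fun [set: Rn R n] (dot theta).
Proof.
apply: measurable_sum => i; apply: measurable_funM => //.
exact: measurable_tnth.
Qed.

Lemma measurable_enorm : measurable_fun [set: Rn R n] enorm.
Proof.
have -> : enorm = fun s : Rn R n => (\sum_(i < n) tnth s i ^+ 2) `^ 2^-1.
  by apply/funext => s; rewrite powR12_sqrt// sumr_ge0// => i _; exact: sqr_ge0.
apply: (@measurableT_comp _ _ _ _ _ _ (@powR R ^~ 2^-1)).
  exact: measurable_powR.
apply: measurable_sum => i; apply: measurable_funX.
exact: measurable_tnth.
Qed.

End euclidean.

Definition sphere (R : realType) (n : nat) : set (Rn R n) :=
  [set s | enorm s = 1].
Arguments sphere R n : clear implicits.

Lemma measurable_sphere (R : realType) n : measurable (sphere R n).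
Proof.
rewrite -[sphere R n]setTI.
exact: (measurable_enorm measurableT (measurable_set1 1)).
Qed.

(* Measures on the sphere are represented by measures on R^n that vanish outside
   the sphere. *)

Section SaS.
Context {R : realType}.

(* E exp(i <theta, X>), computed componentwise. *)
Definition char_fun d (Omega : measurableType d) (P : probability Omega R)
    (n : nat) (X : 'I_n -> {RV P >-> R}) (theta : Rn R n) : R[i] :=
  let Y w := dot theta [tuple X i w | i < n] in
  Complex (\int[P]_(w in setT) cos (Y w)) (\int[P]_(w in setT) sin (Y w)).

(* The scale parameter of <theta, X>, to the power alpha. *)
Definition scale_pow (alpha : R) (n : nat)
    (Gam : {measure set (Rn R n) -> \bar R}) (theta : Rn R n) : R :=
  \int[Gam]_(s in sphere R n) (`|dot theta s| `^ alpha).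

Definition is_SaS (alpha : R) d (Omega : measurableType d)
    (P : probability Omega R) (n : nat) (X : 'I_n -> {RV P >-> R})
    (Gam : {finite_measure set (Rn R n) -> \bar R}) : Prop :=
  [/\ Gam (~` sphere R n) = 0%E,
      forall A, measurable A -> Gam (opp_vec @^-1` A) = Gam A &
      forall theta,
        char_fun X theta = (expR (- scale_pow alpha Gam theta))%:C%C].

End SaS.

(* Spectral measure of the pair (\sum_k a_k X_k, \sum_k b_k X_k). *)

Section linear_image.
Context {R : realType} {n : nat}.
Variables (alpha : R) (a b : Rn R n).

Definition lin2 (s : Rn R n) : Rn R 2 := [tuple dot a s; dot b s].

(* When lin2 s = 0 the result is the zero vector; such s have density 0 for
   alpha > 0. *)
Definition lin2_dir (s : Rn R n) : Rn R 2 :=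
  [tuple tnth (lin2 s) i / enorm (lin2 s) | i < 2].

Definition lin2_weight (s : Rn R n) : R :=
  (dot a s ^+ 2 + dot b s ^+ 2) `^ (alpha / 2).

Lemma measurable_lin2 : measurable_fun [set: Rn R n] lin2.
Proof.
apply/measurable_fun_tnthP => -[[|[|//]] i2].
- exact: measurable_dot a.
- exact: measurable_dot b.
Qed.

Lemma measurable_lin2_dir : measurable_fun [set: Rn R n] lin2_dir.
Proof.
apply/measurable_fun_tnthP => i.
have -> : @tnth 2 (measurableTypeR R) ^~ i \o lin2_dir =
    (fun s => tnth (lin2 s) i * enorm (lin2 s) `^ (-1)).
  by apply/funext => s /=; rewrite tnth_mktuple powR_inv1 ?sqrtr_ge0.
apply: measurable_funM.
  apply: (measurableT_comp (measurable_tnth i)); exact: measurable_lin2.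
apply: (@measurableT_comp _ _ _ _ _ _ (@powR R ^~ (-1))).
  exact: measurable_powR.
apply: measurableT_comp; [exact: measurable_enorm | exact: measurable_lin2].
Qed.

Lemma measurable_lin2_weight : measurable_fun [set: Rn R n] lin2_weight.
Proof.
apply: (@measurableT_comp _ _ _ _ _ _ (@powR R ^~ (alpha / 2))).
  exact: measurable_powR.
by apply: measurable_funD; apply: measurable_funX; exact: measurable_dot.
Qed.

Variable Gam : {measure set (Rn R n) -> \bar R}.

Definition weighted_spectral (A : set (Rn R n)) : \bar R :=
  (\int[Gam]_(s in sphere R n `&` A) (lin2_weight s)%:E)%E.

Let weighted_spectral0 : weighted_spectral set0 = 0%E.
Proof. by rewrite /weighted_spectral setI0 integral_set0. Qed.

Let weighted_spectral_ge0 A : (0 <= weighted_spectral A)%E.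
Proof. by apply: integral_ge0 => s _; rewrite lee_fin powR_ge0. Qed.

Let weighted_spectral_sigma_additive :
  semi_sigma_additive weighted_spectral.
Proof.
move=> F mF tF mUF.
rewrite /weighted_spectral setI_bigcupr ge0_integral_bigcup //=.
- apply: is_cvg_ereal_nneg_natsum_cond => k _ _.
  exact: weighted_spectral_ge0.
- by move=> k; apply: measurableI => //; exact: measurable_sphere.
- apply/measurable_EFinP; apply: measurable_funTS.
  exact: measurable_lin2_weight.
- by move=> s _; rewrite lee_fin powR_ge0.
- exact: trivIset_setIl.
Qed.

HB.instance Definition _ := isMeasure.Build _ _ _ weighted_spectral
  weighted_spectral0 weighted_spectral_ge0 weighted_spectral_sigma_additive.

Definition linear_spectral : set (Rn R 2) -> \bar R :=
  pushforward weighted_spectral lin2_dir.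

Let linear_spectral0 : linear_spectral set0 = 0%E.
Proof. by rewrite /linear_spectral /pushforward preimage_set0 measure0. Qed.

Let linear_spectral_ge0 A : (0 <= linear_spectral A)%E.
Proof. exact: weighted_spectral_ge0. Qed.

Let linear_spectral_sigma_additive : semi_sigma_additive linear_spectral.
Proof.
move=> F mF tF mUF; rewrite /linear_spectral /pushforward preimage_bigcup.
have mpre A : measurable A -> measurable (lin2_dir @^-1` A).
  by move=> mA; rewrite -[X in measurable X]setTI; exact: measurable_lin2_dir.
apply: (@measure_semi_sigma_additive _ _ _ weighted_spectral).
- by move=> k; exact: mpre.
- apply/trivIsetP => /= i j _ _ ij; rewrite -preimage_setI.
  by move/trivIsetP : tF => /(_ _ _ _ _ ij) ->//; rewrite preimage_set0.
- by rewrite -preimage_bigcup; exact: mpre.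
Qed.

HB.instance Definition _ := isMeasure.Build _ _ _ linear_spectral
  linear_spectral0 linear_spectral_ge0 linear_spectral_sigma_additive.

End linear_image.

Section covariation.
Context {R : realType}.

(* powR satisfies 0 `^ 0 = 1, and x ^+ 0 = 1. *)
Definition covK (alpha beta : R) (m : nat) (s1 s2 : R) : R :=
  if `|s1| <= `|s2|
  then `|s1| `^ beta * `|s2| `^ (alpha - beta) * Num.sg (s1 * s2) ^+ m
  else `|s1| `^ (alpha - beta) * `|s2| `^ beta * Num.sg (s1 * s2) ^+ m.

(* Symmetric covariation [X_1, X_2]_{alpha, beta, m} of an SaS pair (X_1, X_2)
   with spectral measure Gam. *)
Definition covariation (alpha beta : R) (m : nat)
    (Gam : {measure set (Rn R 2) -> \bar R}) : R :=
  \int[Gam]_(s in sphere R 2)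
    covK alpha beta m (tnth s ord0) (tnth s ord_max).

End covariation.

Section falling.
Context {R : realType}.

Definition Gamma_integral (x : R) : R :=
  \int[@lebesgue_measure R]_(t in `]0, +oo[) (t `^ (x - 1) * expR (- t)).

(* Euler's integral for x > 0, extended to negative non-integers through
   Gamma (x + 1) = x Gamma x: N is the least natural number with 0 < x + N.
   The value at the poles 0, -1, -2, ... is the junk value 0. *)
Definition Gamma (x : R) : R :=
  let N := if 0 < x then 0%N else (Num.truncn (- x)).+1 in
  Gamma_integral (x + N%:R) / \prod_(i < N) (x + i%:R).

Definition falling (alpha : R) (k : nat) : R :=
  if (alpha \isn't a Num.nat) || (k%:R <= alpha)
  then Gamma (alpha + 1) / Gamma (alpha + 1 - k%:R)
  else 0.

End falling.

(* Main.v *)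
Require Import Defs.
From mathcomp Require Import all_boot all_order all_algebra.
From mathcomp Require Import zify ring lra.
From mathcomp Require Import all_classical all_reals all_analysis.
From mathcomp Require Import measurable_realfun.

Import Order.TTheory GRing.Theory Num.Theory.
Import numFieldNormedType.Exports.

Local Open Scope classical_set_scope.
Local Open Scope ring_scope.

(** The identity holds pointwise before integration.  Put y_1 = theta_1 s_1 and
    y_2 = theta_2 s_2.  If |y_1| <= |y_2| and r = y_1 / y_2, the kernel with
    beta = k and m = k mod 2 equals |y_2|^alpha r^k, the parity of m being what
    restores the sign of r^k; the other case exchanges the two coordinates.
    So the series of kernels is |y_2|^alpha times the binomial series of
    (1 + r)^alpha with r in [-1, 1], and its sum is |y_1 + y_2|^alpha
    ([covK_monomial], [series_covK_cvg]).  Taking the quotient by the larger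
    coordinate is exactly what keeps r in [-1, 1], but the end points are
    reached whenever |y_1| = |y_2|, so the binomial series is needed on the
    closed interval.

    On [-1, 1] the coefficients c_k = alpha (alpha - 1) ... (alpha - k + 1) / k!
    satisfy alpha |c_k| = k |c_k| - (k + 1) |c_(k + 1)| for k >= alpha.  This
    telescopes: sum |c_k| converges, hence k |c_k| has a limit, which is 0 because
    the harmonic series diverges ([cvg_gbinomM_nat]).  The partial sums S_n solve
    (1 + t) S_n' = alpha S_n - n c_n t^(n - 1) ([binomial_sum_ode]), so that the
    derivative of (1 + t)^(-alpha) S_n is a multiple of n c_n; the mean value
    theorem gives the limit on ]-1, 1], and the equation itself taken at t = -1
    gives the remaining point ([binomial_series_cvg]).

    Summability of |c_k| also bounds all partial sums of kernels by a constant on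
    the sphere, and dominated convergence exchanges sum and integral
    ([scale_pow_series]).

    Two translations connect this to the statement.  The covariation of
    (theta_1 X_1, theta_2 X_2) is an integral against the weighted push-forward of
    the spectral measure; the weight is ||y||^alpha and the kernel is homogeneous
    of degree alpha, so it is the integral of the kernel at y against the original
    measure ([covariation_linear_spectral]).  The falling factorial is a quotient
    of Gamma functions; the functional equation of Gamma turns it into the product
    alpha (alpha - 1) ... (alpha - k + 1) ([fallingE]). *)

(** * The Gamma function and falling factorials *)

Section gamma.
Context {R : realType}.
Notation mu := (@lebesgue_measure R).

(** [Gamma_integral] before truncation by [fine]: its functional equation needs
    no prior knowledge of finiteness, and finiteness is deduced from it. *)
Let eGamma (x : R) : \bar R :=
  (\int[mu]_(t in `]0%R, +oo[) (t `^ (x - 1) * expR (- t))%:E)%E.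

Let mGamma (D : set R) x : measurable_fun D (fun t => (t `^ (x - 1) * expR (- t))%:E).
Proof.
apply/measurable_EFinP/measurable_funTS; apply: measurable_funM.
  exact: measurable_powR.
by apply: measurableT_comp.
Qed.

Let Gamma_ge0 (x t : R) : (0 <= (t `^ (x - 1) * expR (- t))%:E)%E.
Proof. by rewrite lee_fin mulr_ge0 ?powR_ge0 ?expR_ge0. Qed.

Lemma cvg_powR_harmonic (x : R) : 0 < x ->
  harmonic n `^ x @[n --> \oo] --> (0 : R).
Proof.
move=> x0; have /cvg_at_rightP := powR_cvg0 x0.
apply; split; last exact: cvg_harmonic.
by move=> n; rewrite /= invr_gt0.
Qed.

(** With N > x, the exponential series gives t^N e^(-t) <= (N + 1)! / t. *)
Lemma cvg_powR_expRN (x : R) : 0 < x ->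
  n.+1%:R `^ x * expR (- n.+1%:R) @[n --> \oo] --> (0 : R).
Proof.
move=> x0; pose N := (Num.truncn x).+1.
apply: (@squeeze_cvgr _ _ _ _ (cst 0) (fun n => N.+1`!%:R * harmonic n)).
- apply: nearW => n /=; rewrite mulr_ge0 ?powR_ge0 ?expR_ge0//=.
  have n1 : 1 <= n.+1%:R :> R by rewrite ler1n.
  rewrite expRN ler_pdivrMr ?expR_gt0//.
  apply: (@le_trans _ _ (n.+1%:R ^+ N)).
    by rewrite -powR_mulrn// ler_powR// ltW// truncnS_gt.
  have := @expR_ge1Dxn R n.+1%:R N (ler0n _ _).
  have f0 : 0 < N.+1`!%:R :> R by rewrite ltr0n fact_gt0.
  move=> H; rewrite mulrAC ler_pdivlMr// -exprSr mulrC -ler_pdivrMr//.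
  by rewrite (le_trans _ H)// lerDr.
- exact: cvg_cst.
- rewrite -[X in _ --> X](mulr0 (N.+1`!%:R : R)).
  by apply: cvgMl_tmp; exact: cvg_harmonic.
Qed.

(** Compact exhaustion of ]0, +oo[; the right end point is n + 2 rather than
    n + 1 so that the segment is nondegenerate for n = 0 as well. *)
Let A n := [set` `[@harmonic R n, n.+2%:R]%R].

Let A_bigcup : \bigcup_n A n = `]0, +oo[%classic :> set R.
Proof.
apply/seteqP; split => [t [n _]|t] /=; rewrite /A /= !in_itv/= ?andbT.
  by move=> /andP[nt _]; apply: lt_le_trans nt; rewrite invr_gt0.
move=> t0; exists (maxn (Num.truncn t) (Num.truncn t^-1)) => //=.
rewrite /A /= in_itv/=; apply/andP; split.
  rewrite -[leRHS]invrK lef_pV2 ?posrE ?invr_gt0//.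
  by rewrite (le_trans (ltW (truncnS_gt _)))// ler_nat ltnS leq_maxr.
by rewrite (le_trans (ltW (truncnS_gt _)))// ler_nat ltnS leqW// leq_maxl.
Qed.

Let A_nd : nondecreasing_seq A.
Proof.
move=> m n mn; rewrite subsetEset => t; rewrite /A /= !in_itv/= => /andP[mt tm].
apply/andP; split.
  by rewrite (le_trans _ mt)// lef_pV2 ?posrE// ler_nat.
by rewrite (le_trans tm)// ler_nat.
Qed.

Let cvg_eGamma x :
  (\int[mu]_(t in A n) (t `^ (x - 1) * expR (- t))%:E)%E @[n --> \oo] -->
  eGamma x.
Proof.
rewrite /eGamma -A_bigcup; apply: ge0_nondecreasing_set_cvg_integral => //.
- by move=> i; exact: measurable_itv.
- by move=> i; exact: mGamma.
Qed.

Let is_derive_LR (f df : R -> R) (a b : R) : a <= b ->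
  (forall t, a <= t <= b -> is_derive t 1 f (df t)) ->
  [/\ derivable_oo_LRcontinuous f a b, {in `]a, b[, derive1 f =1 df} &
      {within `[a, b], continuous f}].
Proof.
move=> ab dfE.
have cf t : a <= t <= b -> f @ t --> f t.
  move=> /dfE[dft _]; apply: differentiable_continuous.
  by rewrite -derivable1_diffP.
split.
- split.
  + move=> t; rewrite in_itv/= => /andP[at_ tb].
    by have [] := dfE t _ => //; rewrite !ltW.
  + by apply: cvg_at_right_filter; apply: cf; rewrite lexx.
  + by apply: cvg_at_left_filter; apply: cf; rewrite lexx andbT.
- move=> t; rewrite in_itv/= => /andP[at_ tb].
  by rewrite derive1E; have [] := dfE t _ => //; rewrite !ltW.
- apply: derivable_within_continuous => t; rewrite in_itv/= => tab.
  by have [] := dfE t tab.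
Qed.

Lemma integral_powR_expRN_parts (x a b : R) : 0 < x -> 0 < a < b ->
  (\int[mu]_(t in `[a, b]) (t `^ x * expR (- t))%:E =
   (a `^ x * expR (- a) - b `^ x * expR (- b))%:E +
   x%:E * \int[mu]_(t in `[a, b]) (t `^ (x - 1) * expR (- t))%:E)%E.
Proof.
move=> x0 /andP[a0 ab].
have dexp (t : R) : is_derive t 1 (fun u => expR (- u)) (- expR (- t)).
  rewrite -[- expR _]mulrN1.
  exact: (@is_derive1_comp _ expR -%R).
have dN (t : R) : is_derive t 1 (fun u => - expR (- u)) (expR (- t)).
  by apply: is_derive_eq; rewrite opprK.
have dpow y (t : R) : a <= t <= b ->
    is_derive t 1 (@powR R ^~ y) (y * t `^ (y - 1)).
  by move=> /andP[at_ _]; apply: is_derive1_powR; exact: lt_le_trans at_.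
have [Fab FE _] := is_derive_LR _ _ _ _ (ltW ab) (dpow x).
have [_ _ cf] := is_derive_LR _ _ _ _ (ltW ab) (dpow (x - 1)).
have [Gab GE _] := is_derive_LR _ _ _ _ (ltW ab) (fun t _ => dN t).
have [_ _ cg] := is_derive_LR _ _ _ _ (ltW ab) (fun t _ => dexp t).
rewrite (integration_by_parts ab _ Fab FE cg Gab GE).
  have xx t : (x * t `^ (x - 1) * - expR (- t))%:E =
      (- (x%:E * (t `^ (x - 1) * expR (- t))%:E))%E.
    by rewrite -EFinM -EFinN mulrN mulrA.
  under eq_integral do rewrite xx.
  rewrite integral_ge0N; last first.
    by move=> t _; rewrite -EFinM lee_fin !mulr_ge0 ?powR_ge0 ?expR_ge0 ?ltW.
  rewrite oppeK ge0_integralZl_EFin ?ltW//.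
    by congr (_%:E + _)%E; ring.
  exact: mGamma.
apply/subspace_continuousP => t tab; apply: cvgM; first exact: cvg_cst.
by move/subspace_continuousP : cf; exact.
Qed.

(** Integration by parts on the compact exhaustion: the boundary terms vanish in
    the limit and both integrals converge to improper ones. *)
Let eGammaS x : 0 < x -> (eGamma (x + 1) = x%:E * eGamma x)%E.
Proof.
move=> x0.
pose c n : R := harmonic n `^ x * expR (- harmonic n) -
  n.+2%:R `^ x * expR (- n.+2%:R).
have c0 : c n @[n --> \oo] --> (0 : R).
  rewrite -[X in _ --> X]subr0; apply: cvgB; last first.
    rewrite (cvg_shiftS (fun n => n.+1%:R `^ x * expR (- n.+1%:R))).
    exact: cvg_powR_expRN.
  apply: (@squeeze_cvgr _ _ _ _ (cst 0) (fun n => harmonic n `^ x)).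
  - apply: nearW => n /=; rewrite mulr_ge0 ?powR_ge0 ?expR_ge0//=.
    by rewrite ler_piMr ?powR_ge0.
  - exact: cvg_cst.
  - exact: cvg_powR_harmonic.
have E n : (\int[mu]_(t in A n) (t `^ (x + 1 - 1) * expR (- t))%:E =
    (c n)%:E + x%:E * \int[mu]_(t in A n) (t `^ (x - 1) * expR (- t))%:E)%E.
  rewrite addrK integral_powR_expRN_parts// invr_gt0 ltr0n/=.
  by rewrite (@le_lt_trans _ _ 1) ?invf_le1 ?ler1n ?ltr1n.
have /cvg_lim <- // := cvg_eGamma (x + 1).
apply/cvg_lim => //; under eq_fun do rewrite E.
rewrite -[(x%:E * _)%E]add0e; apply: cvgeD => //.
  by apply: cvg_EFin => //; apply: nearW.
by apply: cvgeZl => //; exact: cvg_eGamma.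
Qed.

Let eGamma1_lty : (eGamma 1 < +oo)%E.
Proof.
have mpdf : measurable_fun [set: R] (EFin \o exponential_pdf (1 : R)).
  by apply/measurable_EFinP; exact: measurable_exponential_pdf.
apply: (@le_lt_trans _ _ 1%E); last exact: ltry.
rewrite -(@integral_exponential_pdf R 1 ltr01).
have -> : eGamma 1 = (\int[mu]_(t in `]0%R, +oo[) (exponential_pdf 1 t)%:E)%E.
  apply: eq_integral => t /[!inE]/=; rewrite in_itv/= andbT => t0.
  by rewrite subrr powRr0 exponential_pdfE ?ltW// !mulN1r.
apply: ge0_subset_integral => //.
by move=> t _; rewrite lee_fin exponential_pdf_ge0.
Qed.

(** For x in [1, 2], t^(x - 1) <= 1 + t. *)
Let eGamma12_lty x : 1 <= x <= 2 -> (eGamma x < +oo)%E.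
Proof.
move=> /andP[x1 x2]; apply: (@le_lt_trans _ _ (eGamma 1 + eGamma (1 + 1))%E).
  rewrite /eGamma -ge0_integralD//; [|exact: mGamma..].
  apply: ge0_le_integral => //; [exact: mGamma|..].
  - by apply: emeasurable_funD; exact: mGamma.
  move=> t /=; rewrite in_itv/= andbT => t0.
  rewrite -EFinD lee_fin -mulrDl ler_wpM2r ?expR_ge0//.
  rewrite subrr powRr0 addrK (powRr1 (ltW t0)).
  have [t1|t1] := leP t 1.
    rewrite ler_wpDr ?(ltW t0)// -[leRHS](powRr0 t) ger_powR ?t0//.
    by rewrite subr_ge0.
  rewrite ler_wpDl// -[leRHS](powRr1 (ltW t0)) ler_powR ?(ltW t1)//.
  by rewrite lerBlDr.
by rewrite eGammaS// mul1e lte_add_pinfty.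
Qed.

Let eGamma_gt0 x : 1 <= x -> (0 < eGamma x)%E.
Proof.
(* on [1, 2] the integrand is at least e^(-2) *)
move=> x1.
apply: (@lt_le_trans _ _ (\int[mu]_(t in `[1%R, 2%R]) (expR (- 2))%:E)%E).
  rewrite integral_cst//= lebesgue_measure_itv/= lte_fin ltr1n -EFinB -EFinM.
  by rewrite lte_fin mulr_gt0 ?expR_gt0//; lra.
apply: (@le_trans _ _ (\int[mu]_(t in `[1%R, 2%R]) (t `^ (x - 1) * expR (- t))%:E)%E).
  apply: ge0_le_integral => //; [exact: mGamma|..].
  move=> t /=; rewrite in_itv/= => /andP[t1 t2].
  rewrite lee_fin -[leLHS]mul1r ler_pM ?expR_ge0// ?ler_expR ?lerN2//.
  by rewrite -[leLHS](powRr0 t) ler_powR// subr_ge0.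
apply: ge0_subset_integral => //; first exact: mGamma.
by move=> t /=; rewrite !in_itv/= andbT => /andP[t1 _]; lra.
Qed.

(** Being positive and finite is invariant under x |-> x + 1 by the functional
    equation, so it propagates from [1, 2] to all of ]0, +oo[. *)
Lemma Gamma_integral_gt0 (x : R) : 0 < x -> 0 < Gamma_integral x.
Proof.
move=> x0; pose good y := (0 < eGamma y < +oo)%E.
have goodS y : 0 < y -> good (y + 1) = good y.
  move=> y0; rewrite /good eGammaS// pmule_rgt0 ?lte_fin//; congr (_ && _).
  have : (0 <= eGamma y)%E by apply: integral_ge0.
  case: (eGamma y) => [r _|_|]//; last by rewrite gt0_muley ?lte_fin.
  by rewrite -EFinM !ltry.
suff : good x.
  by move=> /andP[g0 gy]; rewrite fine_gt0// g0.
have good12 y : 1 <= y <= 2 -> good y.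
  by move=> /[dup] y12 /andP[y1 _]; rewrite /good eGamma_gt0// eGamma12_lty.
have [n] : exists n : nat, x <= n%:R + 2.
  exists (Num.truncn x).+1; rewrite (le_trans (ltW (truncnS_gt x)))//; lra.
elim: n x x0 => [|n IH] x x0 xn.
  have [x1|x1] := leP 1 x; first by apply: good12; rewrite x1; lra.
  by rewrite -goodS//; apply: good12; apply/andP; split; lra.
have [xn'|xn'] := leP x (n%:R + 2); first exact: IH.
have n0 : 0 <= n%:R :> R by [].
rewrite -(subrK 1 x) goodS; last by lra.
by apply: IH; [|rewrite -natr1 in xn]; lra.
Qed.

Lemma Gamma_integralS (x : R) : 0 < x ->
  Gamma_integral (x + 1) = x * Gamma_integral x.
Proof.
move=> x0; rewrite /Gamma_integral /Rintegral -/(eGamma (x + 1)) -/(eGamma x).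
rewrite eGammaS//; have : (0 <= eGamma x)%E by apply: integral_ge0.
by case: (eGamma x) => [r _|_|]//; rewrite gt0_muley ?lte_fin//= mulr0.
Qed.

(** The definition continues Gamma with the least shift N making x + N positive;
    by the functional equation every larger shift gives the same value. *)
Lemma GammaE (x : R) (N : nat) : 0 < x + N%:R ->
  (forall i, (i < N)%N -> x + i%:R != 0) ->
  Gamma x = Gamma_integral (x + N%:R) / \prod_(i < N) (x + i%:R).
Proof.
move=> xN xi; rewrite /Gamma.
set M := if _ then _ else _.
have xM : 0 < x + M%:R.
  rewrite /M; case: ifPn => [|_]; first by rewrite addr0.
  by rewrite -ltrBlDl sub0r truncnS_gt.
have MN : (M <= N)%N.
  rewrite /M; case: ifPn => // /negbTE; rewrite ltNge => /negbFE x0.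
  by rewrite truncn_lt_nat ?oppr_ge0// ltrNl -subr_gt0 opprK.
have key k : (forall i, (i < M + k)%N -> x + i%:R != 0) ->
    Gamma_integral (x + (M + k)%:R) / \prod_(i < M + k) (x + i%:R) =
    Gamma_integral (x + M%:R) / \prod_(i < M) (x + i%:R).
  elim: k => [|k IH] xk; first by rewrite addn0.
  rewrite -IH => [|i ik]; last by apply: xk; rewrite addnS ltnW.
  rewrite addnS big_ord_recr/= -natr1 addrA Gamma_integralS; last first.
    by rewrite natrD addrA ltr_wpDr.
  by rewrite [X in _ / X]mulrC -mulf_div divff ?mul1r// xk// addnS.
by rewrite -(key (N - M)%N) subnKC.
Qed.

(** The shift N = k evaluates Gamma (alpha + 1 - k) through the integral at
    alpha + 1, which cancels against the numerator and leaves the product.  When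
    alpha is an integer less than k, the product has a zero factor. *)
Lemma fallingE (alpha : R) (k : nat) : 0 < alpha ->
  falling alpha k = \prod_(i < k) (alpha - i%:R).
Proof.
move=> a0; rewrite /falling; case: ifPn => [ak|].
  have ai i : (i < k)%N -> alpha - i%:R != 0.
    move=> ik; rewrite subr_eq0; case/orP: ak => [|ka].
      by apply: contraNN => /eqP ->; rewrite natr_nat.
    by rewrite gt_eqF// (lt_le_trans _ ka)// ltr_nat.
  have a1 : Gamma (alpha + 1) = Gamma_integral (alpha + 1).
    by rewrite (@GammaE _ 0%N) ?addr0 ?big_ord0 ?divr1// addr_gt0.
  have rev : \prod_(i < k) (alpha + 1 - k%:R + i%:R) =
             \prod_(i < k) (alpha - i%:R).
    rewrite (reindex_inj rev_ord_inj)/=; apply: eq_bigr => i _.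
    by rewrite natrB ?ltn_ord// -natr1; ring.
  rewrite a1 (@GammaE _ k) ?subrK ?rev.
  - by rewrite invf_div mulrCA divff ?mulr1// gt_eqF// Gamma_integral_gt0// addr_gt0.
  - by rewrite addr_gt0.
  - move=> i ik; rewrite (_ : _ + _ = alpha - (k - i.+1)%:R); last first.
      by rewrite natrB// -natr1; ring.
    by apply: ai; rewrite subnSK// leq_subr.
rewrite negb_or negbK -ltNge => /andP[/natrP[n ->]].
rewrite ltr_nat => nk; apply/esym/eqP/prodf_eq0.
by exists (Ordinal nk) => //=; rewrite subrr.
Qed.

End gamma.

(** * Generalised binomial coefficients *)

Section binomial_coefficients.
Context {R : realType}.
Implicit Types (a x t : R) (k n : nat).

Definition gbinom a k : R := (\prod_(i < k) (a - i%:R)) / k`!%:R.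

Lemma gbinom0 a : gbinom a 0 = 1.
Proof. by rewrite /gbinom big_ord0 fact0 divr1. Qed.

Lemma gbinomS a k : k.+1%:R * gbinom a k.+1 = (a - k%:R) * gbinom a k.
Proof.
rewrite /gbinom big_ord_recr /= factS natrM.
have h1 : k.+1%:R != 0 :> R by rewrite pnatr_eq0.
have h2 : k`!%:R != 0 :> R by rewrite pnatr_eq0 -lt0n fact_gt0.
by field; rewrite h2 nat1r h1.
Qed.

Lemma gbinom_norm_telescope a k : a <= k%:R ->
  a * `|gbinom a k| = k%:R * `|gbinom a k| - k.+1%:R * `|gbinom a k.+1|.
Proof.
move=> ak; have := congr1 Num.norm (gbinomS a k).
rewrite !normrM normr_nat distrC (@ger0_norm _ (k%:R - a)) ?subr_ge0// => ->.
by ring.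
Qed.

Section summability.
Variable a : R.
Hypothesis a0 : 0 < a.

Let m := (Num.truncn a).+1.

Let le_natDm k : a <= (k + m)%N%:R.
Proof.
by rewrite /m addnS ltW// (lt_le_trans (truncnS_gt _))// ler_nat ltnS leq_addl.
Qed.

(** The telescoping identity makes this quantity constant from rank m on; it
    yields at once the summability of [gbinom a] and the convergence of
    k |gbinom a k|. *)
Let q n := series (fun k => `|gbinom a k|) n + n%:R * `|gbinom a n| / a.

Let q_cst n : q (n + m)%N = q m.
Proof.
elim: n => // n <-; rewrite /q addSn seriesSr.
have := @gbinom_norm_telescope a _ (le_natDm n).
have a_neq0 : a != 0 by rewrite gt_eqF.
set b := `|gbinom a (n + m)%N|; set c := `|gbinom a (n + m)%N.+1| => E.
apply: (mulfI a_neq0); rewrite !mulrDr [a * b]E.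
by field.
Qed.

Lemma is_cvg_series_norm_gbinom : cvgn (series (fun k => `|gbinom a k|)).
Proof.
apply: nondecreasing_is_cvgn.
  by apply: nondecreasing_series => k _ _.
exists (q m) => _ [n _ <-].
apply: (@le_trans _ _ (series (fun k => `|gbinom a k|) (n + m)%N)).
  by apply: nondecreasing_series => //; exact: leq_addr.
by rewrite -(q_cst n) /q lerDl divr_ge0// ?mulr_ge0// ltW.
Qed.

(** The limit exists by the telescoping identity.  Were it positive, |gbinom a k|
    would dominate a multiple of 1 / k and the harmonic series would converge. *)
Lemma cvg_gbinomM_nat : n%:R * `|gbinom a n| @[n --> \oo] --> (0 : R).
Proof.
pose p n : R := n%:R * `|gbinom a n|.
pose u n := p (n + m)%N.
have pE n : u n = a * (q m - series (fun k => `|gbinom a k|) (n + m)%N).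
  by rewrite -(q_cst n) /q addrC addKr mulrC divfK// gt_eqF.
have u_cvg : cvgn u.
  rewrite (funext pE).
  apply: is_cvgMr; apply: is_cvgB; first exact: is_cvg_cst.
  apply/cvg_ex; exists (limn (series (fun k => `|gbinom a k|))).
  by rewrite (cvg_shiftn m (series _)); exact: is_cvg_series_norm_gbinom.
have u_ni : nonincreasing_seq u.
  apply/nonincreasing_seqP => n; rewrite /u /p addSn -subr_ge0.
  by rewrite -gbinom_norm_telescope ?le_natDm// mulr_ge0// ltW.
suff : limn u = 0.
  move=> l0; rewrite -(cvg_shiftn m).
  by have : u @ \oo --> limn u := u_cvg; rewrite l0.
apply/eqP; rewrite eq_le; apply/andP; split; last first.
  by apply: limr_ge => //; apply: nearW => n; rewrite /u /p mulr_ge0.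
rewrite leNgt; apply/negP => l_gt0.
have sub : cvgn (series (fun n => `|gbinom a (n + m.+1)%N|)).
  have -> : series (fun n => `|gbinom a (n + m.+1)%N|) =
      fun n => series (fun k => `|gbinom a k|) (n + m.+1)%N -
               series (fun k => `|gbinom a k|) m.+1.
    apply/funext => n; elim: n => [|n IH].
      by rewrite add0n subrr /series /= big_geq.
    by rewrite addSn (seriesSr _ n) (seriesSr _ (n + m.+1)%N) IH addrAC.
  apply: is_cvgB; last exact: is_cvg_cst.
  apply/cvg_ex; exists (limn (series (fun k => `|gbinom a k|))).
  by rewrite (cvg_shiftn m.+1 (series _)); exact: is_cvg_series_norm_gbinom.
apply: (@dvg_harmonic R).
(* 1 / (n + 1) <= (m + 1) / (n + m + 1), and n + m + 1 >= m puts the index in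
   the range where k |gbinom a k| decreases to its limit *)
apply: (@series_le_cvg _ _
    (fun n => m.+1%:R / limn u * `|gbinom a (n + m.+1)%N|)).
- by move=> n; rewrite /= invr_ge0.
- by move=> n; rewrite /= !mulr_ge0// ?invr_ge0 ltW.
- move=> n.
  have ll : limn u <= (n + m.+1)%N%:R * `|gbinom a (n + m.+1)%N|.
    by rewrite addnS -addSn; exact: nonincreasing_cvgn_ge.
  rewrite /= mulrAC ler_pdivlMr// mulrC ler_pdivrMr//.
  rewrite (le_trans ll)// mulrAC ler_wpM2r// -natrM ler_nat; nia.
- exact: (@is_cvg_seriesZ _ _ (m.+1%:R / limn u) sub).
Qed.

End summability.
End binomial_coefficients.

(** * The binomial series on the closed interval [-1, 1] *)

Section binomial_series.
Context {R : realType}.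
Variable a : R.

Definition binomial_sum (n : nat) (t : R) : R :=
  \sum_(k < n) gbinom a k * t ^+ k.

(** Truncation of the equation (1 + t) f' = a f satisfied by (1 + t)^a.  The
    remainder is a single monomial because the coefficients satisfy the same
    recurrence as those of the full series. *)
Lemma binomial_sum_ode n (t : R) : exists2 D : R,
  is_derive t 1 (binomial_sum n) D &
  (1 + t) * D = a * binomial_sum n t - n%:R * gbinom a n * t ^+ n.-1.
Proof.
elim: n => [|n [D dD DE]].
  exists 0; last by rewrite /binomial_sum big_ord0 !mulr0 !mul0r subrr.
  rewrite (_ : binomial_sum 0 = cst 0); first exact: is_derive_cst.
  by apply/funext => u; rewrite /binomial_sum big_ord0.
exists (D + gbinom a n * (n%:R * t ^+ n.-1)).
  rewrite (_ : binomial_sum n.+1 =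
      binomial_sum n + (fun u => gbinom a n * u ^+ n)); last first.
    by apply/funext => u; rewrite /binomial_sum big_ord_recr.
  apply: is_deriveD.
  rewrite (_ : (fun u => _) = gbinom a n *: id ^+ n :> (R -> R)); last first.
    by apply/funext => u; rewrite /= exprfctE.
  by apply: is_derive_eq; rewrite /GRing.scale /= mulr1.
rewrite /binomial_sum big_ord_recr/= -/(binomial_sum n t) gbinomS mulrDr DE.
by case: n {D dD DE} => [|n] /=; rewrite ?mul0r ?exprS; ring.
Qed.

(** At t = -1 the left-hand side of the differential equation vanishes. *)
Lemma binomial_sumN1 n : a * binomial_sum n.+1 (- 1) =
  n.+1%:R * gbinom a n.+1 * (- 1) ^+ n.
Proof.
have [D _] := binomial_sum_ode n.+1 (- 1).
by rewrite subrr mul0r => /esym/eqP; rewrite subr_eq0 => /eqP.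
Qed.

Lemma normalized_binomial_sum_derive n (t : R) : -1 < t ->
  is_derive t 1 (fun u => (1 + u) `^ (- a) * binomial_sum n u)
    (- (n%:R * gbinom a n * t ^+ n.-1 * (1 + t) `^ (- a - 1))).
Proof.
move=> t1; have [D dD DE] := binomial_sum_ode n t.
have t1' : 0 < 1 + t by lra.
have dP : is_derive t 1 (fun u => (1 + u) `^ (- a))
    (- a * (1 + t) `^ (- a - 1)).
  rewrite (_ : (fun u => (1 + u) `^ (- a)) = @powR R ^~ (- a) \o (+%R 1))//.
  rewrite -[- a * _]mulr1; apply: is_derive1_comp; first exact: is_derive1_powR.
  by apply: is_derive_eq; rewrite add0r.
apply: is_derive_eq; rewrite /GRing.scale /=.
have pE : (1 + t) `^ (- a) = (1 + t) `^ (- a - 1) * (1 + t).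
  rewrite -{3}(powRr1 (ltW t1')) -powRD ?subrK//.
  by apply/implyP => _; exact: lt0r_neq0.
rewrite pE -[_ * _ * D]mulrA DE; ring.
Qed.

Hypothesis a0 : 0 < a.

Let cvg0_gbinom (u : nat -> R) (C : R) :
  (forall n, `|u n.+1| <= C * (n.+1%:R * `|gbinom a n.+1|)) -> u @ \oo --> 0.
Proof.
move=> uC; rewrite -cvg_shiftS; apply/norm_cvg0P.
apply: (@squeeze_cvgr _ _ _ _ (cst 0)
  (fun n => C * (n.+1%:R * `|gbinom a n.+1|))).
- by apply: nearW => n; rewrite /= normr_ge0 uC.
- exact: cvg_cst.
- rewrite -(mulr0 C); apply: cvgMl_tmp.
  rewrite (cvg_shiftS (fun n => n%:R * `|gbinom a n|)).
  exact: cvg_gbinomM_nat.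
Qed.

Lemma binomial_series_cvgN1 : binomial_sum n (- 1) @[n --> \oo] --> (0 : R).
Proof.
apply: (@cvg0_gbinom _ a^-1) => n.
rewrite ler_pdivlMl// -[X in X * `|_|](gtr0_norm a0) -normrM binomial_sumN1.
by rewrite !normrM normrX normrN1 expr1n mulr1 normr_nat.
Qed.

(** Mean value theorem between 0 and x.  The factor in front of the last
    coefficient depends on x, but not on n: it bounds (1 + c)^(-a - 1) for every
    c between 0 and x, by 1 if x >= 0 and by its value at x otherwise. *)
Lemma normalized_binomial_sum_bound n (x : R) : -1 < x <= 1 ->
  `|(1 + x) `^ (- a) * binomial_sum n.+1 x - 1| <=
  (1 + (1 + x) `^ (- a - 1)) * (n.+1%:R * `|gbinom a n.+1|).
Proof.
move=> /andP[x1 x1'].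
pose G u := (1 + u) `^ (- a) * binomial_sum n.+1 u.
pose dG u := - (n.+1%:R * gbinom a n.+1 * u ^+ n * (1 + u) `^ (- a - 1)).
have G0 : G 0 = 1.
  rewrite /G addr0 powR1 mul1r /binomial_sum big_ord_recl gbinom0 expr0 mulr1.
  by rewrite big1 ?addr0// => i _; rewrite /= expr0n mulr0.
have dGE (u : R) : -1 < u -> is_derive u 1 G (dG u).
  by move=> u1; exact: (normalized_binomial_sum_derive n.+1).
have cG (i : interval R) : {in i, forall u : R, -1 < u} ->
    {within [set` i], continuous G}.
  move=> iN1; apply: derivable_within_continuous => u ui.
  by have [] := dGE u (iN1 u ui).
have key (c : R) : -1 < c -> `|c| <= 1 -> (x <= c \/ 0 <= c) ->
    `|dG c| * `|x| <=
    (1 + (1 + x) `^ (- a - 1)) * (n.+1%:R * `|gbinom a n.+1|).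
  move=> c1 c1' xc.
  have x1n : `|x| <= 1 by rewrite ler_norml x1' ltW.
  rewrite (le_trans (ler_piMr _ x1n))// /dG normrN !normrM normr_nat normrX.
  rewrite mulrC ler_pM//; last first.
    by rewrite ler_piMr ?mulr_ge0// exprn_ile1.
  rewrite ger0_norm ?powR_ge0//.
  have ler_powN (u v : R) : 0 < u <= v -> v `^ (- a - 1) <= u `^ (- a - 1).
    move=> /andP[u0 uv]; have v0 := lt_le_trans u0 uv.
    rewrite -opprD !powRN lef_pV2 ?posrE ?powR_gt0// ge0_ler_powR// ?nnegrE ltW//.
    by rewrite addr_gt0.
  case: xc => [xc|c0].
    by rewrite -[leLHS]add0r lerD ?ler01// ler_powN//; apply/andP; split; lra.
  rewrite -[leLHS]addr0 lerD ?powR_ge0// (le_trans (ler_powN 1 _ _)) ?powR1//.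
  by apply/andP; split; lra.
have [x0|x0] := leP 0 x.
- have [||c] := @MVT_segment R G dG 0 x x0.
  + by move=> u /[!in_itv]/= /andP[u0 _]; apply: dGE; lra.
  + by apply: cG => u /[!in_itv]/= /andP[u0 _]; lra.
  rewrite in_itv/= subr0 G0 => /andP[c0 cx] ->.
  by rewrite normrM key//; [lra|rewrite ger0_norm; lra|right].
- have [||c] := @MVT_segment R G dG x 0 (ltW x0).
  + by move=> u /[!in_itv]/= /andP[u0 _]; apply: dGE; lra.
  + by apply: cG => u /[!in_itv]/= /andP[u0 _]; lra.
  rewrite in_itv/= sub0r G0 => /andP[c0 cx] E.
  rewrite distrC E normrM (normrN x) key//; [lra|rewrite ler0_norm; lra|by left].
Qed.

Lemma binomial_series_cvg (x : R) : -1 <= x <= 1 ->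
  binomial_sum n x @[n --> \oo] --> (1 + x) `^ a.
Proof.
move=> /andP[]; rewrite le_eqVlt => /predU1P[<- _|x1 x1'].
  by rewrite subrr powR0 ?gt_eqF//; exact: binomial_series_cvgN1.
have x1p : 0 < 1 + x by lra.
pose G n := (1 + x) `^ (- a) * binomial_sum n x.
have G1 : G n - 1 @[n --> \oo] --> (0 : R).
  apply: cvg0_gbinom => n; apply: normalized_binomial_sum_bound.
  by rewrite x1 x1'.
have -> : binomial_sum ^~ x = (fun n => (1 + x) `^ a * (G n - 1 + 1)).
  apply/funext => n; rewrite subrK /G mulrA -powRD ?subrr ?powRr0 ?mul1r//.
  by rewrite lt0r_neq0// implybT.
rewrite -[X in _ --> X]mulr1; apply: cvgMl_tmp.
rewrite -[X in _ --> X]add0r; apply: cvgD => //; exact: cvg_cst.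
Qed.

End binomial_series.

(** * The covariation kernel *)

Section covK.
Context {R : realType}.
Implicit Types (alpha beta : R) (m : nat).

Lemma covK_homogeneous alpha beta m (c x y : R) : 0 < c ->
  covK alpha beta m (c * x) (c * y) = c `^ alpha * covK alpha beta m x y.
Proof.
move=> c0; have c0' := ltW c0.
have sgc : Num.sg (c * x * (c * y)) = Num.sg (x * y).
  by rewrite mulrACA sgrM gtr0_sg ?mul1r// mulr_gt0.
have cE : c `^ alpha = c `^ beta * c `^ (alpha - beta).
  rewrite -powRD; first by rewrite addrC subrK.
  by apply/implyP => _; exact: lt0r_neq0.
rewrite /covK sgc !normrM (gtr0_norm c0) ler_pM2l// cE.
by case: ifPn => _; rewrite !powRM//; ring.
Qed.

(** One of the exponents beta and alpha - beta is nonzero. *)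
Lemma covK00 alpha beta m : alpha != 0 -> covK alpha beta m 0 0 = 0 :> R.
Proof.
move=> a0; rewrite /covK normr0 lexx.
have [->|b0] := eqVneq beta 0; last by rewrite (powR0 b0) !mul0r.
by rewrite subr0 (powR0 a0) mulr0 mul0r.
Qed.

Lemma measurable_covK d (T : measurableType d) alpha beta m (f g : T -> R) :
  measurable_fun [set: T] f -> measurable_fun [set: T] g ->
  measurable_fun [set: T] (fun t => covK alpha beta m (f t) (g t)).
Proof.
move=> mf mg.
have mn (h : T -> R) p : measurable_fun [set: T] h ->
    measurable_fun [set: T] (fun t => `|h t| `^ p).
  move=> mh; apply: (@measurableT_comp _ _ _ _ _ _ (@powR R ^~ p)).
    exact: measurable_powR.
  exact: measurableT_comp.
have msg : measurable_fun [set: T] (fun t => Num.sg (f t * g t) ^+ m).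
  apply: measurable_funX.
  (* sg z = z * |z|^(-1), also for z = 0 *)
  rewrite (_ : (fun t => _) = fun t => f t * g t * `|f t * g t| `^ (-1)).
    apply: measurable_funM; first exact: measurable_funM.
    by apply: mn; exact: measurable_funM.
  apply/funext => t; rewrite powR_inv1//.
  have [->|fg0] := eqVneq (f t * g t) 0; first by rewrite sgr0 mul0r.
  by rewrite {2}(numEsg (f t * g t)) mulfK ?normr_eq0.
apply: measurable_fun_ifT.
- by apply: measurable_fun_ler; exact: measurableT_comp.
- by apply: measurable_funM => //; apply: measurable_funM; exact: mn.
- by apply: measurable_funM => //; apply: measurable_funM; exact: mn.
Qed.

End covK.

(** * The series of kernels *)

Section series_of_kernels.
Context {R : realType}.
Variable alpha : R.
Hypothesis alpha0 : 0 < alpha.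

Let sgr_expr_parity (x z : R) k : (z == 0 -> x == 0) ->
  Num.sg z ^+ (k %% 2) * x ^+ k = (Num.sg z * x) ^+ k.
Proof.
have [->|z0] := eqVneq z 0; rewrite exprMn; last first.
  move=> _; congr (_ * _).
  by rewrite {2}(divn_eq k 2) exprD (mulnC _ 2) exprM sqr_sg z0 expr1n mul1r.
move=> /(_ isT)/eqP ->; case: k => [|k]; first by rewrite mod0n.
by rewrite !exprS !mul0r !mulr0.
Qed.

(** The number r is the coordinate of smaller modulus divided by the other one,
    and 0 if both vanish.  Since r carries the sign of x * y, the factor
    sign^(k mod 2) is exactly the sign of r^k. *)
Lemma covK_monomial (x y : R) : exists2 r : R, -1 <= r <= 1 &
  (forall k, covK alpha k%:R (k %% 2) x y = Num.max `|x| `|y| `^ alpha * r ^+ k)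
  /\ `|x + y| `^ alpha = Num.max `|x| `|y| `^ alpha * (1 + r) `^ alpha.
Proof.
wlog xy : x y / `|x| <= `|y| => [H|].
  have /orP[/H//|yx] := le_total `|x| `|y|.
  have [r r1 [rK rE]] := H y x yx; exists r => //.
  rewrite maxC (addrC x); split => // k; rewrite -rK /covK yx.
  case: ifPn => [xy|_]; last by rewrite (mulrC x) (mulrC (`|x| `^ _)).
  have -> : `|x| = `|y| by apply: le_anti; rewrite xy yx.
  by rewrite (mulrC x).
rewrite (max_r xy); have [y0|y0] := eqVneq y 0.
  have x0 : x = 0 by move: xy; rewrite y0 normr0 normr_le0 => /eqP.
  exists 0; first by rewrite lerN10 ler01.
  rewrite x0 y0 addr0 normr0 powR0 ?gt_eqF//.
  split => [k|]; last by rewrite mul0r.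
  by rewrite covK00 ?mul0r// gt_eqF.
have ny0 : 0 < `|y| by rewrite normr_gt0.
exists (x / y); first by rewrite -ler_norml normrM normfV ler_pdivrMr// mul1r.
have r1 : 0 <= 1 + x / y.
  have : `|x / y| <= 1 by rewrite normrM normfV ler_pdivrMr// mul1r.
  by rewrite ler_norml => /andP[]; rewrite -subr_ge0 opprK addrC.
split => [k|].
  have sE : Num.sg (x * y) * `|x| = `|y| * (x / y).
    rewrite sgrM mulrAC -numEsg (normrEsg y); field; exact: y0.
  rewrite /covK xy powRB ?normr_eq0 ?y0 ?implybT// !powR_mulrn//.
  rewrite mulrAC (mulrC (`|x| ^+ k)) sgr_expr_parity ?sE; last first.
    by rewrite mulf_eq0 (negbTE y0) orbF normr_eq0.
  by rewrite exprMn mulrC -mulrA mulKf// expf_neq0// gt_eqF.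
rewrite -powRM//; congr (_ `^ _).
by rewrite -(ger0_norm r1) -normrM; congr `|_|; field.
Qed.

Lemma series_covK_cvg (x y : R) :
  series (fun k =>
    falling alpha k / k`!%:R * covK alpha k%:R (k %% 2) x y) @ \oo -->
  `|x + y| `^ alpha.
Proof.
have [r r1 [rK ->]] := covK_monomial x y.
set M := Num.max _ _ `^ alpha.
have -> : series (fun k =>
      falling alpha k / k`!%:R * covK alpha k%:R (k %% 2) x y) =
    fun n => M * binomial_sum alpha n r.
  apply/funext => n; rewrite /series/= big_mkord /binomial_sum mulr_sumr.
  by apply: eq_bigr => k _; rewrite rK fallingE// mulrCA.
by apply: cvgMl_tmp; exact: binomial_series_cvg.
Qed.

Definition gbinom_norm_sum : R := limn (series (fun k => `|gbinom alpha k|)).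

Lemma covK_bound k (x y : R) :
  `|covK alpha k%:R (k %% 2) x y| <= Num.max `|x| `|y| `^ alpha.
Proof.
have [r r1 [-> _]] := covK_monomial x y.
rewrite normrM (ger0_norm (powR_ge0 _ _)) ler_piMr ?powR_ge0// normrX.
by rewrite exprn_ile1// ler_norml.
Qed.

Lemma series_covK_bound n (x y : R) :
  `|series (fun k =>
      falling alpha k / k`!%:R * covK alpha k%:R (k %% 2) x y) n| <=
  gbinom_norm_sum * Num.max `|x| `|y| `^ alpha.
Proof.
apply: (@le_trans _ _
  (series (fun k => `|gbinom alpha k|) n * Num.max `|x| `|y| `^ alpha)).
  rewrite /series/= (le_trans (ler_norm_sum _ _ _))// mulr_suml ler_sum// => k _.
  by rewrite normrM fallingE// ler_wpM2l// covK_bound.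
rewrite ler_wpM2r ?powR_ge0//; apply: nondecreasing_cvgn_le.
  by apply: nondecreasing_series => k _ _.
exact: is_cvg_series_norm_gbinom.
Qed.

End series_of_kernels.

(** * Integrals against the spectral measure of a linear image *)

Section density.
Context d (T : measurableType d) (R : realType).
Variables (nu mu : {measure set T -> \bar R}) (D : set T) (w : T -> R).
Hypothesis mD : measurable D.
Hypothesis mw : measurable_fun [set: T] w.
Hypothesis w0 : forall x, 0 <= w x.
Hypothesis nuE : forall A, measurable A ->
  nu A = (\int[mu]_(x in D `&` A) (w x)%:E)%E.
Local Open Scope ereal_scope.
Import HBNNSimple.

Let mwD E : measurable_fun E (EFin \o w).
Proof. by apply: measurable_funTS; exact/measurable_EFinP. Qed.

Let nnsfun_density (h : {nnsfun T >-> R}) :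
  \int[nu]_x (h x)%:E = \int[mu]_(x in D) ((h x)%:E * (w x)%:E).
Proof.
rewrite integralT_nnsfun sintegralE.
under [RHS]eq_integral => x _.
  rewrite fimfunE -fsumEFin// ge0_mule_fsuml; last first.
    by move=> y; exact: nnfun_muleindic_ge0.
  over.
rewrite ge0_integral_fsum//; last 2 first.
- move=> r; apply: emeasurable_funM; last exact: mwD.
  by apply/measurable_EFinP; apply: measurable_funM => //; exact: measurable_funTS.
- move=> r x _; rewrite mule_ge0 ?lee_fin ?w0//.
  exact: nnfun_muleindic_ge0.
apply: eq_fsbigr => r /set_mem [t _ <-].
have mA : measurable (h @^-1` [set h t]) by [].
under eq_integral do rewrite EFinM -muleA.
rewrite ge0_integralZl//.
- rewrite nuE//; congr (_ * _).
  rewrite (integral_mkcondr mu D); apply: eq_integral => x _.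
  by rewrite patchE /indic; case: ifPn => _; rewrite ?mul1e ?mul0e.
- apply: emeasurable_funM; last exact: mwD.
  by apply/measurable_EFinP; exact: measurable_funTS.
- by move=> x _; rewrite mule_ge0 ?lee_fin ?w0.
- by rewrite lee_fin.
Qed.

Lemma ge0_integral_density (h : T -> \bar R) :
  measurable_fun [set: T] h -> (forall x, 0 <= h x) ->
  \int[nu]_x h x = \int[mu]_(x in D) (h x * (w x)%:E).
Proof.
move=> mh h0; pose f := nnsfun_approx measurableT mh.
have fh x : (EFin \o f n) x @[n --> \oo] --> h x by exact: cvg_nnsfun_approx.
have nd_f x : nondecreasing_seq (fun n => (EFin \o f n) x).
  by move=> m n mn; rewrite lee_fin; exact/lefP/nd_nnsfun_approx.
transitivity (limn (fun n => \int[nu]_x (EFin \o f n) x)).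
  rewrite -monotone_convergence//.
  - by apply: eq_integral => x _; apply/esym/cvg_lim => //; exact: fh.
  - by move=> n; exact/measurable_EFinP.
  - by move=> n x _; rewrite lee_fin.
under eq_fun do rewrite nnsfun_density.
rewrite -monotone_convergence//.
- apply: eq_integral => x _; apply/cvg_lim => //.
  by apply: cvgeZr => //; exact: fh.
- move=> n; apply: emeasurable_funM; last exact: mwD.
  by apply/measurable_EFinP; exact: measurable_funTS.
- by move=> n x _; rewrite mule_ge0 ?lee_fin.
- by move=> x _ m n mn; rewrite lee_wpmul2r ?lee_fin//; exact: nd_f.
Qed.

End density.

Section change_of_variables.
Context {R : realType} {n : nat}.
Variables (alpha : R) (a b : Rn R n) (Gam : {measure set (Rn R n) -> \bar R}).

Local Notation ls := (linear_spectral alpha a b Gam).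
Local Notation dir := (lin2_dir a b).
Local Notation wgt := (lin2_weight alpha a b).

Lemma ge0_integral_linear_spectral (f : Rn R 2 -> \bar R) :
  measurable_fun [set: Rn R 2] f -> (forall s, (0 <= f s)%E) ->
  (\int[ls]_s f s = \int[Gam]_(s in sphere R n) (f (dir s) * (wgt s)%:E))%E.
Proof.
move=> mf f0; rewrite /linear_spectral.
rewrite ge0_integral_pushforward//; last exact: measurable_lin2_dir.
rewrite preimage_setT (@ge0_integral_density _ _ _ _ Gam (sphere R n) wgt)//.
- exact: measurable_sphere.
- exact: measurable_lin2_weight.
- by move=> s; exact: powR_ge0.
- by apply: measurableT_comp => //; exact: measurable_lin2_dir.
- by move=> s; exact: f0.
Qed.

(** The weight is nonnegative, so it commutes with taking positive and negative
    parts, which reduces the claim to nonnegative functions. *)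
Lemma Rintegral_linear_spectral (f : Rn R 2 -> R) :
  measurable_fun [set: Rn R 2] f ->
  \int[ls]_s f s = \int[Gam]_(s in sphere R n) (f (dir s) * wgt s).
Proof.
move=> mf; congr fine; rewrite [LHS]integralE [RHS]integralE.
have mEf := (measurable_EFinP _ _).2 mf.
have w0 s : 0 <= wgt s by exact: powR_ge0.
congr (_ - _)%E; rewrite ge0_integral_linear_spectral//.
- apply: eq_integral => s _; rewrite !funeposE /=.
  by rewrite -!EFin_max -EFinM maxr_pMl// mul0r.
- exact: measurable_funepos.
- apply: eq_integral => s _; rewrite !funenegE /=.
  by rewrite -!EFin_max -EFinM maxr_pMl// mul0r mulNr.
- exact: measurable_funeneg.
Qed.

Lemma enorm_lin2 s : enorm (lin2 a b s) = Num.sqrt (dot a s ^+ 2 + dot b s ^+ 2).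
Proof. by rewrite /enorm big_ord_recl big_ord1 !(tnth_nth 0). Qed.

Lemma lin2_weightE s : wgt s = enorm (lin2 a b s) `^ alpha.
Proof.
rewrite enorm_lin2 /lin2_weight.
by rewrite mulrC powRrM powR12_sqrt// addr_ge0// sqr_ge0.
Qed.

Lemma enorm_lin2_dir s : enorm (lin2 a b s) != 0 -> enorm (dir s) = 1.
Proof.
move=> y0; rewrite /enorm.
under eq_bigr do rewrite tnth_mktuple exprMn.
rewrite -mulr_suml exprVn /enorm sqr_sqrtr; last first.
  by apply: sumr_ge0 => i _; exact: sqr_ge0.
rewrite divff ?sqrtr1//; apply: contra_neq y0 => y0.
by rewrite /enorm y0 sqrtr0.
Qed.

(** Homogeneity of the kernel absorbs the weight ||y||^alpha.  Where y = 0, the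
    direction is not on the unit sphere, but the weight and the kernel both
    vanish there. *)
Lemma covariation_linear_spectral (beta : R) m : 0 < alpha ->
  covariation alpha beta m ls =
  \int[Gam]_(s in sphere R n) covK alpha beta m (dot a s) (dot b s).
Proof.
move=> alpha0; rewrite /covariation Rintegral_mkcond Rintegral_linear_spectral.
  apply: eq_Rintegral => s _; rewrite lin2_weightE patchE.
  have [y0|y0] := eqVneq (enorm (lin2 a b s)) 0.
    have : dot a s ^+ 2 + dot b s ^+ 2 = 0.
      apply/eqP; rewrite eq_le addr_ge0 ?sqr_ge0// andbT -sqrtr_eq0.
      by rewrite -enorm_lin2 y0.
    move=> /eqP; rewrite paddr_eq0 ?sqr_ge0// !sqrf_eq0 => /andP[/eqP -> /eqP ->].
    by rewrite y0 powR0 ?covK00 ?mulr0// gt_eqF.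
  have c0 : 0 < (enorm (lin2 a b s))^-1.
    by rewrite invr_gt0 lt_neqAle eq_sym y0 sqrtr_ge0.
  rewrite mem_set/=; last exact: enorm_lin2_dir.
  have -> : tnth (dir s) ord0 = (enorm (lin2 a b s))^-1 * dot a s.
    by rewrite tnth_mktuple mulrC (tnth_nth 0).
  have -> : tnth (dir s) ord_max = (enorm (lin2 a b s))^-1 * dot b s.
    by rewrite tnth_mktuple mulrC (tnth_nth 0).
  rewrite covK_homogeneous// mulrAC -powRM ?(ltW c0) ?sqrtr_ge0//.
  by rewrite mulVf// powR1 mul1r.
apply/(measurable_restrictT _ _).1; first exact: measurable_sphere.
apply: measurable_funTS; apply: measurable_covK; exact: measurable_tnth.
Qed.

End change_of_variables.

(** * Integration of the series term by term *)

Section integrated_series.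
Context {R : realType}.
Variables (alpha : R) (Gam : {finite_measure set (Rn R 2) -> \bar R}).
Variables (theta1 theta2 : R).
Hypothesis alpha0 : 0 < alpha.

Let S := sphere R 2.
Let f k (s : Rn R 2) :=
  covK alpha k%:R (k %% 2) (dot [tuple theta1; 0] s) (dot [tuple 0; theta2] s).

Let dot2 (p q : R) (s : Rn R 2) :
  dot [tuple p; q] s = p * tnth s ord0 + q * tnth s ord_max.
Proof. by rewrite /dot big_ord_recl big_ord1 !(tnth_nth 0). Qed.

Let C := (`|theta1| + `|theta2|) `^ alpha.

Let max_bound s : S s ->
  Num.max `|dot [tuple theta1; 0] s| `|dot [tuple 0; theta2] s| `^ alpha <= C.
Proof.
move=> Ss; have s1 i : `|tnth s i| <= 1.
  rewrite -(@expr_le1 _ 2)// real_normK ?num_real//.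
  have <- : \sum_(i < 2) tnth s i ^+ 2 = 1.
    have s0 : 0 <= \sum_(i < 2) tnth s i ^+ 2.
      by apply: sumr_ge0 => j _; exact: sqr_ge0.
    by rewrite -(sqr_sqrtr s0) -/(enorm s) Ss expr1n.
  by rewrite (bigD1 i)//= lerDl; apply: sumr_ge0 => j _; exact: sqr_ge0.
rewrite ge0_ler_powR ?nnegrE ?addr_ge0 ?(ltW alpha0)//.
rewrite !dot2 !mul0r addr0 add0r !normrM ge_max; apply/andP; split.
  by rewrite ler_wpDr// ler_piMr.
by rewrite ler_wpDl// ler_piMr.
Qed.

Let mS : measurable S. Proof. exact: measurable_sphere. Qed.

Let bounded_integrable (h : Rn R 2 -> R) (B : R) :
  measurable_fun [set: Rn R 2] h -> (forall s, S s -> `|h s| <= B) ->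
  Gam.-integrable S (EFin \o h).
Proof.
move=> mh hB; apply: (@le_integrable _ _ _ _ _ _ _ (EFin \o cst B)) => //.
- by apply/measurable_EFinP; exact: measurable_funTS.
- by move=> s Ss; rewrite /= lee_fin (le_trans (hB s Ss))// ler_norm.
- exact: finite_measure_integrable_cst.
Qed.

Let mf k : measurable_fun [set: Rn R 2] (f k).
Proof. by apply: measurable_covK; exact: measurable_dot. Qed.

Let integrable_f k : Gam.-integrable S (EFin \o f k).
Proof.
apply: (bounded_integrable _ C) => // s Ss.
by rewrite (le_trans (covK_bound _ alpha0 _ _ _))// max_bound.
Qed.

Let c k := falling alpha k / k`!%:R.

Let msum n :
  measurable_fun [set: Rn R 2] (fun s => series (fun k => c k * f k s) n).
Proof.
by rewrite /series/=; apply: measurable_sum => k; apply: measurable_funM.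
Qed.

Let sum_bound n s : S s ->
  `|series (fun k => c k * f k s) n| <= gbinom_norm_sum alpha * C.
Proof.
move=> Ss; rewrite (le_trans (series_covK_bound _ alpha0 _ _ _))//.
rewrite ler_wpM2l ?max_bound//.
apply: limr_ge; first exact: is_cvg_series_norm_gbinom.
by apply: nearW => k; apply: sumr_ge0.
Qed.

Let integral_partial_sum n :
  series (fun k => c k * \int[Gam]_(s in S) f k s) n =
  \int[Gam]_(s in S) series (fun k => c k * f k s) n.
Proof.
elim: n => [|n IH].
  rewrite /series/= big_geq//; apply/esym; rewrite -[RHS](mul0r (fine (Gam S))).
  by rewrite -Rintegral_cst//; apply: eq_Rintegral => s _; rewrite big_geq.
rewrite seriesSr IH -RintegralZl// -RintegralD//.
- by apply: eq_Rintegral => s _; rewrite seriesSr.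
- apply: (bounded_integrable _ (gbinom_norm_sum alpha * C)); first exact: msum.
  by move=> s; exact: sum_bound.
- apply: (bounded_integrable _ (`|c n| * C)); first exact: measurable_funM.
  move=> s Ss; rewrite normrM ler_wpM2l//.
  by rewrite (le_trans (covK_bound _ alpha0 _ _ _))// max_bound.
Qed.

Lemma scale_pow_series : series (fun k => c k * \int[Gam]_(s in S) f k s) @ \oo -->
  scale_pow alpha Gam [tuple theta1; theta2].
Proof.
rewrite (funext integral_partial_sum).
pose g n s := (series (fun k => c k * f k s) n)%:E.
have [] := @dominated_convergence _ _ _ Gam S mS g
  (fun s => (`|dot [tuple theta1; theta2] s| `^ alpha)%:E)
  (cst (gbinom_norm_sum alpha * C)%:E).
- by move=> n; apply/measurable_EFinP; exact: measurable_funTS.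
- apply/measurable_EFinP/measurable_funTS.
  apply: (@measurableT_comp _ _ _ _ _ _ (@powR R ^~ alpha)).
    exact: measurable_powR.
  by apply: measurableT_comp => //; exact: measurable_dot.
- apply: aeW => s Ss; apply: cvg_EFin; first exact: nearW.
  rewrite dot2 (_ : theta1 * _ + _ =
    dot [tuple theta1; 0] s + dot [tuple 0; theta2] s).
    exact: series_covK_cvg.
  by rewrite !dot2 !mul0r addr0 add0r.
- exact: finite_measure_integrable_cst.
- by apply: aeW => s n Ss; rewrite /g/= lee_fin sum_bound.
move=> limI _ cvgI; apply: fine_cvg.
by rewrite /scale_pow /Rintegral fineK// integrable_fin_num.
Qed.

End integrated_series.

Theorem theorem4p3 (R : realType) (d : measure_display)
    (Omega : measurableType d) (P : probability Omega R)
    (alpha : R) (X : 'I_2 -> {RV P >-> R})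
    (Gamma_X : {finite_measure set (Rn R 2) -> \bar R}) :
  0 < alpha <= 2 ->
  is_SaS alpha X Gamma_X ->
  forall theta1 theta2 : R,
    series (fun k : nat =>
      falling alpha k / k`!%:R *
      covariation alpha k%:R (k %% 2)
        (linear_spectral alpha [tuple theta1; 0] [tuple 0; theta2] Gamma_X))
    @ \oo --> scale_pow alpha Gamma_X [tuple theta1; theta2].
Proof.
move=> /andP[alpha0 _] _ theta1 theta2.
under eq_fun do rewrite covariation_linear_spectral//.
exact: scale_pow_series.
Qed.
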